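(* Let $P=(p_{xy})$ be an ergodic reversible Markov chain on $X=\{1,\ldots,n\}$ with stationary distribution $\pi$, and assume that all eigenvalues of $P$ are positive. Then: (1) for all $z\in X$, $\mathsf{QHT}(P,z)\le\sqrt{\mathsf{HT}(P,z)/2}$; (2) for all $z\in X$ and all $\varepsilon\in(0,1)$, $\mathsf{QHT}_\varepsilon(P,z)=\sqrt{\mathsf{HT}_\varepsilon(P,z)}$.
   Context: Classical quantities: $\mathsf{HT}(P,z)$ is the expected number of steps for the chain started from $\pi$ to reach $z$. Let $P_{-z}$ be $P$ with row and column $z$ deleted, $\Pi_{-z}=\mathrm{diag}(\pi_x)_{x\ne z}$, $S_{-z}=\sqrt{\Pi_{-z}}P_{-z}\sqrt{\Pi_{-z}}^{-1}$ (real symmetric with eigenvalues in $[0,1)$), $v_1,\ldots,v_{n-1}$ an orthonormal eigenbasis of $S_{-z}$ with eigenvalues $\cos\theta_j$, $0<\theta_j\le\pi/2$, and $\sqrt{\pi_{-z}}=\sum_j\nu_jv_j$ (entrywise square root of $\pi$ without coordinate $z$). $H_z$ takes value $1/\theta_j^2$ with probability $\nu_j^2$ and $0$ with probability $1-\sum_j\nu_j^2$; $\mathsf{HT}_\varepsilon(P,z)=\min\{y:\Pr[H_z>y]\le\varepsilon\}$. Quantum quantities: on $\mathcal H=\mathbb C^{X\times X}$ let $|p_x\rangle=\sum_y\sqrt{p_{xy}}|y\rangle$, $\mathcal A=\mathrm{Span}(|x\rangle|p_x\rangle:x\in X)$, $\mathrm{ref}(\mathcal A)=2\Pi_{\mathcal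 A}-I$ where $\Pi_{\mathcal A}$ is the orthogonal projector onto $\mathcal A$, and $\mathsf{SWAP}|x\rangle|y\rangle=|y\rangle|x\rangle$. Set $U_2=\mathsf{SWAP}\cdot\mathrm{ref}(\mathcal A)$, $|\phi_0\rangle=\sum_x\sqrt{\pi_x}|x\rangle|p_x\rangle$, $|\mu\rangle=|z\rangle|p_z\rangle$, $U=U_2(I-2|\mu\rangle\langle\mu|)$ and $|\tilde\phi_0\rangle=|\phi_0\rangle-\langle\mu|\phi_0\rangle|\mu\rangle=\sum_{x\ne z}\sqrt{\pi_x}|x\rangle|p_x\rangle$. Decompose $|\tilde\phi_0\rangle=\delta_0|w_0\rangle+\sum_j\delta_j(|w_j^+\rangle+|w_j^-\rangle)+\delta_{-1}|w_{-1}\rangle$ with real coefficients in unit eigenvectors of the real unitary $U$ (eigenvalues $1$, $-1$, and $e^{\pm i\alpha_j}$ with $0<\alpha_j<\pi$, $|w_j^-\rangle=\overline{|w_j^+\rangle}$). $\mathit{QH}$ takes value $1/\alpha_j$ w.p. $2\delta_j^2$, $1/\pi$ w.p. $\delta_{-1}^2$, $0$ otherwise. Then $\mathsf{QHT}(P,z)=\mathbb E[\mathit{QH}]$ and $\mathsf{QHT}_\varepsilon(P,z)=\min\{y:\Pr[\mathit{QH}>y]\le\varepsilon\}$. *)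

(* Defs.v *)
From mathcomp Require Import all_boot all_order all_algebra.
From mathcomp Require Import all_classical all_reals all_analysis.
From mathcomp Require Import complex.

Set Implicit Arguments.
Unset Strict Implicit.
Unset Printing Implicit Defensive.

Import Order.TTheory GRing.Theory Num.Theory.
Local Open Scope ring_scope.

Section MarkovChain.
Variables (R : realType) (n : nat).
Implicit Types (P : 'M[R]_n) (stat : 'I_n -> R).

Definition stochastic P :=
  (forall x y, 0 <= P x y) /\ (forall x, \sum_y P x y = 1).

Definition irreducible P := forall x y, exists t : nat, 0 < (P ^+ t) x y.

Definition aperiodic P :=
  forall (x : 'I_n) (d : nat),
    (forall t : nat, (0 < t)%N -> 0 < (P ^+ t) x x -> (d %| t)%N) -> d = 1%N.

Definition ergodic P := [/\ stochastic P, irreducible P & aperiodic P].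

Definition stationary P stat :=
  [/\ forall x, 0 <= stat x, \sum_x stat x = 1
    & forall y, \sum_x stat x * P x y = stat y].

Definition reversible P stat := forall x y, stat x * P x y = stat y * P y x.

(* all (complex) eigenvalues of P are positive (in particular real). *)
Definition eigenvalues_positive P :=
  forall l : R[i], eigenvalue (map_mx (fun a : R => (a%:C)%C) P) l -> 0 < l.

Definition path_prob P stat (t : nat) (s : {ffun 'I_t.+1 -> 'I_n}) : R :=
  stat (s ord0) * \prod_(i < t) P (s (widen_ord (leqnSn t) i)) (s (lift ord0 i)).

(* Pr_stat[ T_z > t ] = Pr[ X_0, ..., X_t all differ from z ],
   where T_z = min {t >= 0 : X_t = z} *)
Definition not_hit_prob P stat (z : 'I_n) (t : nat) : R :=
  \sum_(s : {ffun 'I_t.+1 -> 'I_n} | [forall i, s i != z]) path_prob P stat s.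

(* HT(P,z) = E_stat[T_z] = sum_{t >= 0} Pr[T_z > t]  (finite for ergodic P) *)
Definition HT P stat (z : 'I_n) : R :=
  fine (\sum_(0 <= t <oo) ((not_hit_prob P stat z t)%:E))%E.

Definition Xmz (z : 'I_n) := {x : 'I_n | x != z}.

Definition Smz P stat (z : 'I_n) (x y : Xmz z) : R :=
  Num.sqrt (stat (val x)) * P (val x) (val y) / Num.sqrt (stat (val y)).

Definition classical_eigenbasis P stat (z : 'I_n)
    (v : Xmz z -> Xmz z -> R) (theta : Xmz z -> R) :=
  [/\ forall j k, \sum_x v j x * v k x = (j == k)%:R,
      forall j x, \sum_y Smz P stat x y * v j y = cos (theta j) * v j x
    & forall j, 0 < theta j <= pi / 2].

Definition nu stat (z : 'I_n) (v : Xmz z -> Xmz z -> R) (j : Xmz z) : R :=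
  \sum_x v j x * Num.sqrt (stat (val x)).

(* Pr[H_z > y], where H_z = 1/theta_j^2 w.p. nu_j^2 and 0 otherwise *)
Definition Hz_tail stat (z : 'I_n) (v : Xmz z -> Xmz z -> R) (theta : Xmz z -> R) (y : R) : R :=
  \sum_j (if y < (theta j ^+ 2)^-1 then nu stat v j ^+ 2 else 0)
  + (if y < 0 then 1 - \sum_j nu stat v j ^+ 2 else 0).

Definition HT_eps stat (z : 'I_n) (v : Xmz z -> Xmz z -> R) (theta : Xmz z -> R) (eps : R) : R :=
  inf [set y : R | Hz_tail stat v theta y <= eps].

(* H = C^{X x X}; basis indexed by pairs *)
Definition XX := ('I_n * 'I_n)%type.

Definition psi P (x : 'I_n) (k : XX) : R :=
  if k.1 == x then Num.sqrt (P x k.2) else 0.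

(* Pi_A: the |x>|p_x> are orthonormal (P stochastic), so the orthogonal
   projector onto A is sum_x |x,p_x><x,p_x| *)
Definition projA P (k l : XX) : R := \sum_x psi P x k * psi P x l.

Definition refA P (k l : XX) : R := 2 * projA P k l - (k == l)%:R.

(* U_2 = SWAP . ref(A) *)
Definition U2 P (k l : XX) : R := refA P (k.2, k.1) l.

Definition Uop P (z : 'I_n) (k l : XX) : R :=
  \sum_m U2 P k m * ((m == l)%:R - 2 * psi P z m * psi P z l).

Definition phit P stat (z : 'I_n) (k : XX) : R :=
  \sum_(x | x != z) Num.sqrt (stat x) * psi P x k.

Definition applyC (A : XX -> XX -> R) (u : XX -> R[i]) (k : XX) : R[i] :=
  \sum_l ((A k l)%:C)%C * u l.

Definition normsq (u : XX -> R[i]) : R :=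
  \sum_k (@complex.Re R (u k) ^+ 2 + @complex.Im R (u k) ^+ 2).

(* Decomposition |phi~_0> = delta_0 |w_0> + sum_j delta_j (|w_j^+> + |w_j^->)
   + delta_{-1} |w_{-1}>, written with the (non-normalised) components
   u0 = delta_0 w_0, um1 = delta_{-1} w_{-1}, u j = delta_j w_j^+
   (so w_j^- = conj w_j^+ gives the conjugate component), with
   U u0 = u0, U um1 = - um1, U (u j) = e^{i alpha_j} u j,
   0 < alpha_j < pi pairwise distinct. *)
Definition quantum_decomp P stat (z : 'I_n) (m : nat) (alpha : 'I_m -> R)
    (u0 um1 : XX -> R[i]) (u : 'I_m -> XX -> R[i]) :=
  [/\ forall k, applyC (Uop P z) u0 k = u0 k,
      forall k, applyC (Uop P z) um1 k = - um1 k,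
      forall j k, applyC (Uop P z) (u j) k
                  = Complex (cos (alpha j)) (sin (alpha j)) * u j k,
      (forall j, 0 < alpha j < pi) /\ injective alpha
    & forall k, ((phit P stat z k)%:C)%C
                = u0 k + um1 k + \sum_j (u j k + conjc (u j k))].

(* QHT = E[QH], QH = 1/alpha_j w.p. 2 delta_j^2, 1/pi w.p. delta_{-1}^2,
   0 otherwise *)
Definition QHT (m : nat) (alpha : 'I_m -> R) (um1 : XX -> R[i])
    (u : 'I_m -> XX -> R[i]) : R :=
  \sum_j (2 * normsq (u j)) / alpha j + normsq um1 / pi.

Definition QH_tail (m : nat) (alpha : 'I_m -> R) (um1 : XX -> R[i])
    (u : 'I_m -> XX -> R[i]) (y : R) : R :=
  \sum_j (if y < (alpha j)^-1 then 2 * normsq (u j) else 0)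
  + (if y < pi^-1 then normsq um1 else 0)
  + (if y < 0 then 1 - \sum_j 2 * normsq (u j) - normsq um1 else 0).

Definition QHT_eps (m : nat) (alpha : 'I_m -> R) (um1 : XX -> R[i])
    (u : 'I_m -> XX -> R[i]) (eps : R) : R :=
  inf [set y : R | QH_tail alpha um1 u y <= eps].

End MarkovChain.

(* Main.v *)
Require Import Defs.
From mathcomp Require Import all_boot all_order all_algebra.
From mathcomp Require Import all_classical all_reals all_analysis.
From mathcomp Require Import complex ring lra.
Import Order.TTheory GRing.Theory Num.Theory.
Local Open Scope ring_scope.

(** Since [mu] lies in the span [A], the operator [U] is [SWAP (2 T T^t - 1)],
    where the isometry [T] sends the basis vector of [x <> z] to [|x>|p_x>], and
    [S = T^t SWAP T] is the matrix [S_{-z}].  If [U w = e^{i alpha} w] then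
    [T^t w] is an eigenvector of [S] for [cos alpha], and [|w|^2 = 2 |T^t w|^2]
    when [sin alpha <> 0].  As [+1] and [-1] are not eigenvalues of [S], the
    [(+1)]- and [(-1)]-eigenvectors of [U] are orthogonal to the range of [T], so
    the [(-1)]-component of [T sqrt(pi_{-z})] vanishes.  Comparing the images of
    the decomposition under [T^t] and [T^t SWAP] shows that the vectors
    [T^t (delta_j w_j^+)] are real.  Hence [sqrt(pi_{-z}) = \sum_j y_j] where
    [S y_j = cos(alpha_j) y_j] and [|y_j|^2 = 2 delta_j^2].

    Then [Pr(T_z > t) = \sum_j cos(alpha_j)^t |y_j|^2], so that
    [HT = \sum_j |y_j|^2 / (1 - cos(alpha_j))], and (1) follows from
    [1 - cos a <= a^2 / 2] and the Cauchy-Schwarz inequality.  For (2), [y_j]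
    is the projection of [sqrt(pi_{-z})] on an eigenspace of [S], hence
    [Pr(QH > y) = Pr(H_z > y^2)] for [y >= 0]. *)

(** * Bilinear form on functions over a finite index set, and orthogonality of eigenvectors *)

Section Dot.
Context {R : comRingType} {I : finType}.
Implicit Types u v w : I -> R.

Definition dot u v : R := \sum_i u i * v i.

Lemma eq_dotr w u v : u =1 v -> dot w u = dot w v.
Proof. by move=> e; apply: eq_bigr => i _; rewrite e. Qed.

Lemma dotC u v : dot u v = dot v u.
Proof. by apply: eq_bigr => i _; rewrite mulrC. Qed.

Lemma dotD w u v : dot w (fun i => u i + v i) = dot w u + dot w v.
Proof. by rewrite -big_split; apply: eq_bigr => i _; rewrite mulrDr. Qed.

Lemma dotZ w a u : dot w (fun i => a * u i) = a * dot w u.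
Proof. by rewrite /dot mulr_sumr; apply: eq_bigr => i _; rewrite mulrCA. Qed.

Lemma dot0 w u : u =1 (fun=> 0) -> dot w u = 0.
Proof. by move=> e; rewrite (eq_dotr _ _ _ e) /dot big1 // => i _; rewrite mulr0. Qed.

Lemma dot_sum (J : finType) w (F : J -> I -> R) :
  dot w (fun i => \sum_j F j i) = \sum_j dot w (F j).
Proof.
by rewrite /dot exchange_big; apply: eq_bigr => i _; rewrite mulr_sumr.
Qed.

Lemma dot_comp_involutive (f : I -> I) u v :
  involutive f -> dot (u \o f) v = dot u (v \o f).
Proof.
move=> fK; rewrite /dot (reindex_inj (inv_inj fK)).
by apply: eq_bigr => i _ /=; rewrite fK.
Qed.

Lemma dot_delta (i : I) u : dot (fun j => (i == j)%:R) u = u i.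
Proof.
rewrite /dot (bigD1 i) //= eqxx mul1r big1 ?addr0 // => j.
by rewrite eq_sym => /negbTE ->; rewrite mul0r.
Qed.

End Dot.

Section RealDot.
Context {R : realDomainType} {I : finType}.
Implicit Types u v : I -> R.

Lemma dot_ge0 u : 0 <= dot u u.
Proof. by apply: sumr_ge0 => i _; rewrite -expr2 sqr_ge0. Qed.

Lemma dot_eq0P u : dot u u = 0 -> u =1 (fun=> 0).
Proof.
move=> /psumr_eq0P e i; apply/eqP; rewrite -sqrf_eq0 expr2; apply/eqP.
by apply: e => // j _; rewrite -expr2 sqr_ge0.
Qed.

End RealDot.

Section Orthogonal.
Context {R : realFieldType} {I : finType}.
Variable S : I -> I -> R.
Hypothesis S_sym : forall x y, S x y = S y x.

Definition eigenvec (c : R) (a : I -> R) :=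
  forall x, \sum_y S x y * a y = c * a x.

Lemma eigenvec_orthogonal c d a b :
  eigenvec c a -> eigenvec d b -> c != d -> dot a b = 0.
Proof.
move=> ea eb ncd; apply/eqP.
suff : (c - d) * dot a b == 0 by rewrite mulf_eq0 subr_eq0 (negbTE ncd).
rewrite mulrBl subr_eq0 /dot !mulr_sumr.
under eq_bigr do rewrite mulrA -ea mulr_suml.
under [X in _ == X]eq_bigr do rewrite mulrCA -eb mulr_sumr.
rewrite exchange_big; apply/eqP; apply: eq_bigr => x _; apply: eq_bigr => y _.
by rewrite S_sym; ring.
Qed.

End Orthogonal.

(** * Walk operator [U] of an isometry [T] and an involution [sw] *)

Section Walk.
Context {R : realFieldType} {I K : finType}.
Variables (T : I -> K -> R) (sw : K -> K).
Hypothesis swK : involutive sw.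
Hypothesis T_orthonormal : forall x y, dot (T x) (T y) = (x == y)%:R.

(** [embed] is the map [T] of the overview and [coembed] its transpose; [discriminant] is
    [S = T^t SWAP T] and [walk] is [U = SWAP (2 T T^t - 1)]. *)
Definition embed (a : I -> R) (k : K) : R := \sum_x a x * T x k.

Definition coembed (p : K -> R) (x : I) : R := dot (T x) p.

Definition discriminant (x y : I) : R := dot (T x) (T y \o sw).

Definition walk (p : K -> R) (k : K) : R :=
  2 * embed (coembed p) (sw k) - p (sw k).

Lemma dot_embed p a : dot p (embed a) = dot (coembed p) a.
Proof.
rewrite /embed dot_sum; apply: eq_bigr => x _.
by rewrite dotZ dotC mulrC.
Qed.

Lemma coembed_T x : coembed (T x) =1 (fun y => (x == y)%:R).
Proof. by move=> y; rewrite /coembed T_orthonormal eq_sym. Qed.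

Lemma coembed_T_swap x : coembed (T x \o sw) =1 discriminant^~ x.
Proof. by []. Qed.

Lemma discriminant_sym x y : discriminant x y = discriminant y x.
Proof. by rewrite /discriminant -dot_comp_involutive // dotC. Qed.

Lemma coembedK a : coembed (embed a) =1 a.
Proof.
by move=> x; rewrite /coembed dot_embed dotC (eq_dotr _ _ _ (coembed_T x)) dotC dot_delta.
Qed.

Lemma dot_walk w p :
  dot w (walk p) =
  2 * dot (coembed (w \o sw)) (coembed p) - dot (w \o sw) p.
Proof.
rewrite (eq_dotr _ _ (fun k => 2 * (embed (coembed p) \o sw) k + -1 * (p \o sw) k)).
  by rewrite dotD !dotZ -!(dot_comp_involutive sw) // dot_embed mulN1r.
by move=> k; rewrite /walk /= mulN1r.
Qed.

(** As [T^t T = 1] and [SWAP] squares to [1], [T^t SWAP U = 2 T^t - T^t = T^t]. *)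
Lemma dot_walk_T x p : dot (T x \o sw) (walk p) = coembed p x.
Proof.
rewrite dot_walk (_ : (T x \o sw) \o sw = T x); last first.
  by apply/funext => k /=; rewrite swK.
rewrite dotC (eq_dotr _ _ _ (coembed_T x)) dotC dot_delta /coembed; ring.
Qed.

(** The relation [T^t U = 2 S T^t - T^t SWAP]; together with [T^t SWAP U = T^t] it turns
    eigenvectors of [U] into eigenvectors of [S]. *)
Lemma dot_walk_T_swap x p :
  dot (T x) (walk p) =
  2 * (\sum_y discriminant x y * coembed p y) - coembed (p \o sw) x.
Proof.
rewrite dot_walk; congr (2 * _ - _); last by rewrite dot_comp_involutive.
by apply: eq_bigr => y _; rewrite coembed_T_swap discriminant_sym.
Qed.

Lemma coembed_swap p x : coembed (p \o sw) x = dot (T x \o sw) p.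
Proof. by rewrite dot_comp_involutive. Qed.

(** * Real and imaginary parts of an eigenvector [w = p + i q] of the walk for [c + i s] *)

Section RotationPair.
Variables (c s : R) (p q : K -> R).
Hypothesis cs1 : c ^+ 2 + s ^+ 2 = 1.
Hypothesis walk_p : walk p =1 (fun k => c * p k - s * q k).
Hypothesis walk_q : walk q =1 (fun k => s * p k + c * q k).

Let dot_walk_p w : dot w (walk p) = c * dot w p - s * dot w q.
Proof.
rewrite (eq_dotr _ _ _ walk_p) (eq_dotr _ _ (fun k => c * p k + - s * q k)).
  by rewrite dotD !dotZ mulNr.
by move=> k; rewrite mulNr.
Qed.

Let dot_walk_q w : dot w (walk q) = s * dot w p + c * dot w q.
Proof. by rewrite (eq_dotr _ _ _ walk_q) dotD !dotZ. Qed.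

(** Inverting the rotation in [T^t SWAP U w = T^t w] gives [T^t SWAP w = (c - i s) T^t w]. *)
Lemma rotation_coembed_swap x :
  coembed (p \o sw) x = c * coembed p x + s * coembed q x /\
  coembed (q \o sw) x = - s * coembed p x + c * coembed q x.
Proof.
have := dot_walk_p (T x \o sw); have := dot_walk_q (T x \o sw).
rewrite !dot_walk_T -!coembed_swap => -> ->.
move: cs1; set u := coembed _ x; set v := coembed _ x => h.
have hs : s ^+ 2 = 1 - c ^+ 2 by lra.
by split; ring: hs.
Qed.

(** Inserting [T^t SWAP w = (c - i s) T^t w] into [T^t U w = 2 S T^t w - T^t SWAP w] leaves
    [2 S T^t w = 2 c T^t w]. *)
Lemma rotation_eigenvec :
  eigenvec discriminant c (coembed p) /\ eigenvec discriminant c (coembed q).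
Proof.
by split=> x; have [e1 e2] := rotation_coembed_swap x;
  have := dot_walk_p (T x); have := dot_walk_q (T x);
  rewrite !dot_walk_T_swap e1 e2 -/(coembed p x) -/(coembed q x);
  set u := coembed p x; set v := coembed q x; lra.
Qed.

Lemma rotation_normsq : s != 0 ->
  dot p p + dot q q =
  2 * (dot (coembed p) (coembed p) + dot (coembed q) (coembed q)).
Proof.
move=> s0.
have swC f : (f \o sw) \o sw = f by apply/funext => k /=; rewrite swK.
have := dot_walk_p (p \o sw); have := dot_walk_q (q \o sw).
have := dot_walk_p p; have := dot_walk_q q.
rewrite !dot_walk !swC.
have -> : dot (coembed (p \o sw)) (coembed p) =
   c * dot (coembed p) (coembed p) + s * dot (coembed p) (coembed q).
  rewrite dotC -!dotZ -dotD; apply: eq_dotr => x.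
  by have [-> _] := rotation_coembed_swap x.
have -> : dot (coembed (q \o sw)) (coembed q) =
   - s * dot (coembed p) (coembed q) + c * dot (coembed q) (coembed q).
  rewrite dotC [dot (coembed p) _]dotC -!dotZ -dotD; apply: eq_dotr => x.
  by have [_ ->] := rotation_coembed_swap x.
rewrite [dot q p]dotC [dot (q \o sw) p]dot_comp_involutive // [dot q (p \o sw)]dotC.
set A := dot (coembed p) (coembed p); set B := dot (coembed q) (coembed q).
set C := dot (coembed p) (coembed q).
set pp := dot (p \o sw) p; set qq := dot (q \o sw) q; set pq := dot (p \o sw) q.
set N := dot p p; set N' := dot q q; set X := dot p q.
move=> e1 e2 e3 e4.
(* Pairing the walk with the vectors and with their swaps gives two linear relations between
   [A + B], [N + N'] and the overlap [pp + qq]; eliminating the first two shows that [s ^+ 2] times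
   the overlap vanishes. *)
have M0 : s ^+ 2 * (pp + qq) = 0.
  have h : 2 * (A + B) = N + N' + c * (pp + qq) by lra.
  have h' : c * (2 * (A + B)) = pp + qq + c * (N + N') by lra.
  have -> : s ^+ 2 = 1 - c ^+ 2 by rewrite -cs1; ring.
  by move: h'; rewrite h; lra.
have /eqP : pp + qq = 0.
  by apply/eqP; move/eqP: M0; rewrite mulf_eq0 expf_eq0 (negbTE s0).
rewrite addr_eq0 => /eqP e; move: e1 e2 e3 e4; rewrite e; lra.
Qed.

(** Such a [w] satisfies [U^t w = - w], so its products with [p] and [q] solve a homogeneous system
    of determinant [(1 + c)^2 + s^2 > 0]. *)
Lemma rotation_orthogonal w : s != 0 ->
  w \o sw =1 w -> coembed w =1 (fun=> 0) -> dot w p = 0.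
Proof.
move=> s0 /funext ew w0.
have := dot_walk_p w; have := dot_walk_q w.
rewrite !dot_walk ew ![dot (coembed w) _]dotC !(dot0 _ _ w0).
set u := dot w p; set v := dot w q => e1 e2.
have hu : (1 + c) * u = s * v by lra.
have hv : (1 + c) * v = - s * u by lra.
have /eqP : ((1 + c) ^+ 2 + s ^+ 2) * u = 0.
  by rewrite mulrDl expr2 -mulrA hu mulrCA hv; ring.
rewrite mulf_eq0 => /orP[|/eqP//].
by rewrite paddr_eq0 ?sqr_ge0 // [s ^+ 2 == 0]sqrf_eq0 (negbTE s0) andbF.
Qed.

End RotationPair.

(** * Splitting a vector in the range of [T] along eigenvectors of the walk *)

Section Decomposition.
Variables (m : nat) (c s : 'I_m -> R) (p q : 'I_m -> K -> R).
Variables (p0 p1 : K -> R) (a : I -> R).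
Hypothesis no_unit_eigenvec : forall (e : R) (b : I -> R),
  e ^+ 2 = 1 -> eigenvec discriminant e b -> b =1 (fun=> 0).

(** From [T^t SWAP U = T^t] one gets [T^t SWAP f = e T^t f], hence [S T^t f = e T^t f] and
    [T^t f = 0]; on such [f] the walk is [- SWAP]. *)
Lemma walk_sign_eigenvec e f : e ^+ 2 = 1 -> walk f =1 (fun k => e * f k) ->
  [/\ coembed f =1 (fun=> 0), coembed (f \o sw) =1 (fun=> 0)
    & f \o sw =1 (fun k => - e * f k)].
Proof.
move=> e1 wf.
have E w : dot w (walk f) = e * dot w f by rewrite (eq_dotr _ _ _ wf) dotZ.
have E1 x : coembed f x = e * coembed (f \o sw) x.
  by rewrite coembed_swap -E dot_walk_T.
have E2 x : coembed (f \o sw) x = e * coembed f x.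
  by rewrite E1 mulrA -expr2 e1 mul1r.
have f0 : coembed f =1 (fun=> 0).
  apply: (no_unit_eigenvec e) => // x.
  have := E (T x); rewrite dot_walk_T_swap E2 -/(coembed f x); lra.
split=> // [x|k]; first by rewrite E2 f0 mulr0.
have := wf k; rewrite /walk /= mulNr => <-.
by rewrite /embed big1 ?mulr0 ?sub0r ?opprK // => x _; rewrite f0 mul0r.
Qed.

Hypothesis cs1 : forall j, c j ^+ 2 + s j ^+ 2 = 1.
Hypothesis s_neq0 : forall j, s j != 0.
Hypothesis c_inj : injective c.
Hypothesis walk_p : forall j, walk (p j) =1 (fun k => c j * p j k - s j * q j k).
Hypothesis walk_q : forall j, walk (q j) =1 (fun k => s j * p j k + c j * q j k).
Hypothesis walk_p0 : walk p0 =1 p0.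
Hypothesis walk_p1 : walk p1 =1 (fun k => - p1 k).
Hypothesis decomp : embed a =1 (fun k => p0 k + p1 k + \sum_j 2 * p j k).

Let p0E : [/\ coembed p0 =1 (fun=> 0), coembed (p0 \o sw) =1 (fun=> 0)
    & p0 \o sw =1 (fun k => - 1 * p0 k)].
Proof.
by apply: walk_sign_eigenvec => [|k]; rewrite ?expr1n // walk_p0 mul1r.
Qed.

Let p1E : [/\ coembed p1 =1 (fun=> 0), coembed (p1 \o sw) =1 (fun=> 0)
    & p1 \o sw =1 (fun k => - (-1) * p1 k)].
Proof.
by apply: walk_sign_eigenvec => [|k]; rewrite ?sqrrN ?expr1n // walk_p1 mulN1r.
Qed.

Let dot_decomp w :
  dot w (embed a) = dot w p0 + dot w p1 + \sum_j 2 * dot w (p j).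
Proof.
rewrite (eq_dotr _ _ _ decomp) !dotD dot_sum.
by congr (_ + _); apply: eq_bigr => j _; rewrite dotZ.
Qed.

(** Pairing the decomposition with [p1] leaves only its squared norm: [p1] is swap-symmetric and
    killed by [T^t], hence orthogonal to the range of [T] and to each [p j], while [p0] is
    swap-antisymmetric. *)
Lemma minus_one_component_eq0 : p1 =1 (fun=> 0).
Proof.
have [h0 _ h0'] := p0E; have [h1 _ h1'] := p1E.
have h1s : p1 \o sw =1 p1 by move=> k; rewrite h1' opprK mul1r.
apply: dot_eq0P.
have := dot_decomp p1; rewrite dot_embed dotC dot0 // big1 => [|j _].
  have : dot p1 p0 = - dot p1 p0; last lra.
  rewrite -{1}(funext h1s) dot_comp_involutive // (eq_dotr _ _ _ h0') dotZ.
  by rewrite mulN1r.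
by rewrite (rotation_orthogonal _ _ _ _ (walk_p j) (walk_q j)) ?mulr0.
Qed.

Lemma decomp_coembed x : a x = \sum_j 2 * coembed (p j) x.
Proof.
have [h0 _ _] := p0E; have [h1 _ _] := p1E.
by rewrite -[LHS]coembedK /coembed dot_decomp -!/(coembed _ x) h0 h1 !add0r.
Qed.

Lemma coembed_imag_eq0 j : coembed (q j) =1 (fun=> 0).
Proof.
have [h0 h0' _] := p0E; have [h1 h1' _] := p1E.
(* Applying [T^t SWAP] to the decomposition gives [S a] on one side; its terms [c i * coembed (p i)]
   cancel against those of the other side. *)
have sum0 x : \sum_i s i * coembed (q i) x = 0.
  have := dot_decomp (T x \o sw).
  rewrite dot_embed -!coembed_swap h0' h1' !add0r.
  under eq_bigr => i _ do rewrite -coembed_swap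
    (proj1 (rotation_coembed_swap _ _ _ _ (cs1 i) (walk_p i) (walk_q i) x)) mulrDr.
  rewrite big_split /=.
  have -> : dot (coembed (T x \o sw)) a = \sum_i 2 * (c i * coembed (p i) x).
    rewrite (eq_dotr _ _ _ decomp_coembed) dot_sum.
    apply: eq_bigr => i _; rewrite dotZ; congr (_ * _).
    have [<- _] := rotation_eigenvec _ _ _ _ (cs1 i) (walk_p i) (walk_q i).
    by apply: eq_bigr => y _; rewrite coembed_T_swap discriminant_sym.
  rewrite -mulr_sumr => /eqP; rewrite eq_sym -subr_eq0 addrAC subrr add0r -mulr_sumr.
  by rewrite mulf_eq0 pnatr_eq0 /= => /eqP.
(* The [coembed (q i)] are eigenvectors of [S] for distinct [c i], so pairing the zero sum with the
   [j]-th one isolates its squared norm. *)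
apply: dot_eq0P.
have := dot0 (coembed (q j)) _ sum0.
rewrite dot_sum (bigD1 j) //= big1 => [|i nij].
  by rewrite addr0 dotZ => /eqP; rewrite mulf_eq0 (negbTE (s_neq0 j)) => /eqP.
rewrite dotZ (eigenvec_orthogonal _ discriminant_sym (c j) (c i)) ?mulr0 //.
- by have [] := rotation_eigenvec _ _ _ _ (cs1 j) (walk_p j) (walk_q j).
- by have [] := rotation_eigenvec _ _ _ _ (cs1 i) (walk_p i) (walk_q i).
- by rewrite eq_sym (inj_eq c_inj).
Qed.

(** The vector [y_j] of the overview; the factor 2 accounts for the conjugate pair. *)
Definition spectral_component j x := 2 * coembed (p j) x.

Lemma spectral_component_normsq j :
  dot (spectral_component j) (spectral_component j) =
  2 * (dot (p j) (p j) + dot (q j) (q j)).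
Proof.
rewrite (rotation_normsq _ _ _ _ (cs1 j) (walk_p j) (walk_q j)) //.
rewrite [dot (coembed (q j)) _]dot0; last exact: coembed_imag_eq0.
by rewrite dotZ dotC dotZ addr0; ring.
Qed.

Lemma spectral_component_eigenvec j :
  eigenvec discriminant (c j) (spectral_component j).
Proof.
move=> x; have [e _] := rotation_eigenvec _ _ _ _ (cs1 j) (walk_p j) (walk_q j).
rewrite mulrCA -e mulr_sumr; apply: eq_bigr => y _.
by rewrite /spectral_component mulrCA.
Qed.

End Decomposition.

End Walk.

(** * The reversible chain: irreducibility, stationary law and spectrum of [S_{-z}] *)

Section Chain.
Context {R : realType} {n : nat}.
Variables (P : 'M[R]_n) (stat : 'I_n -> R).

Lemma big_Xmz (z : 'I_n) (F : 'I_n -> R) :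
  \sum_(x | x != z) F x = \sum_(x : Xmz z) F (val x).
Proof. exact: (big_sub [pred x | x != z]). Qed.

Lemma big_Xmz_null (z : 'I_n) (F : 'I_n -> R) :
  F z = 0 -> \sum_x F x = \sum_(x : Xmz z) F (val x).
Proof. by move=> F0; rewrite -big_Xmz (bigD1 z) //= F0 add0r. Qed.

Lemma irreducible_ind (Q : 'I_n -> Prop) :
  (forall x y, 0 <= P x y) -> irreducible P ->
  (forall x y, 0 < P x y -> Q x -> Q y) -> forall x y, Q x -> Q y.
Proof.
move=> P0 irr step x y; have [t] := irr x y.
elim: t x => [|t IH] x.
  by rewrite expr0 mxE; case: eqP => [->//|_]; rewrite mulr0n ltxx.
rewrite exprS mxE => /lt0r_neq0.
have Pt0 (w : 'I_n) : 0 <= (P ^+ t) w y.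
  elim: (t) w => [|k IHk] w; first by rewrite expr0 mxE ler0n.
  by rewrite exprS mxE sumr_ge0 // => v _; rewrite mulr_ge0.
rewrite psumr_neq0 => [/hasP[w _ /=]|w _]; last exact: mulr_ge0.
move=> h Qx; have Pw : P x w != 0 by apply: contraTneq h => ->; rewrite mul0r ltxx.
apply: (IH w); last by apply: step Qx; rewrite lt0r Pw P0.
by rewrite lt0r Pt0 andbT; apply: contraTneq h => ->; rewrite mulr0 ltxx.
Qed.

Hypothesis erg : ergodic P.
Hypothesis sta : stationary P stat.
Hypothesis rev : reversible P stat.

Let P_ge0 x y : 0 <= P x y. Proof. by case: erg => -[]. Qed.

Let P_sum x : \sum_y P x y = 1. Proof. by case: erg => -[]. Qed.

Let stat_ge0 x : 0 <= stat x. Proof. by case: sta. Qed.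

Let P_irr : irreducible P. Proof. by case: erg. Qed.

(** Some state has positive mass since the total is 1, and detailed balance propagates positivity
    along transitions. *)
Lemma stationary_gt0 x : 0 < stat x.
Proof.
have [_ sum1 _] := sta.
have : \sum_y stat y != 0 by rewrite sum1 oner_neq0.
rewrite psumr_neq0 => [/hasP[y _ /= y0]|y _]; last exact: stat_ge0.
apply: (irreducible_ind (fun w => 0 < stat w)) y0 => // v w Pvw v0.
rewrite lt0r stat_ge0 andbT.
have : stat v * P v w != 0 by rewrite mulf_neq0 ?gt_eqF.
by apply: contraNneq => w0; rewrite rev w0 mul0r.
Qed.

Lemma sqrt_stat_neq0 x : Num.sqrt (stat x) != 0.
Proof. by rewrite gt_eqF // sqrtr_gt0 stationary_gt0. Qed.

Lemma sqr_sqrt_stat x : Num.sqrt (stat x) ^+ 2 = stat x.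
Proof. by rewrite sqr_sqrtr. Qed.

Variable z : 'I_n.

(* Irreducibility makes [z] reachable from everywhere, and the Dirichlet form of
   an eigenvector for [+1] or [-1], extended by [0] at [z], vanishes. *)
Lemma Smz_no_unit_eigenvec (e : R) (b : Xmz z -> R) :
  e ^+ 2 = 1 -> eigenvec (Smz P stat (z := z)) e b -> b =1 (fun=> 0).
Proof.
move=> e1 eb.
(* Dividing by [Num.sqrt (stat x)] undoes the symmetrization in [Smz], so [P f = e f] off [z]. *)
pose f x := if insub x is Some x' then b x' / Num.sqrt (stat x) else 0.
have fz : f z = 0 by rewrite /f insubF // eqxx.
have fE (x : Xmz z) : f (val x) = b x / Num.sqrt (stat (val x)).
  by rewrite /f valK.
have stat_f : \sum_x stat x * f x ^+ 2 = dot b b.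
  rewrite (big_Xmz_null z) ?fz ?expr0n ?mulr0 //.
  apply: eq_bigr => x _; rewrite fE expr_div_n sqr_sqrt_stat mulrCA divff ?mulr1 //.
  by rewrite gt_eqF // stationary_gt0.
have cross : \sum_x \sum_y stat x * P x y * (f x * f y) = e * dot b b.
  rewrite (big_Xmz_null z); last by rewrite big1 // => y _; rewrite fz mul0r mulr0.
  rewrite -dotZ; apply: eq_bigr => x _; rewrite -eb mulr_sumr.
  rewrite (big_Xmz_null z); last by rewrite fz !mulr0.
  apply: eq_bigr => y _; rewrite !fE -{1}(sqr_sqrt_stat (val x)) /Smz; field.
  by rewrite !sqrt_stat_neq0.
(* By stationarity and [e ^+ 2 = 1] the sum expands to [2 |b|^2 - 2 e * (e |b|^2) = 0]. *)
have dirichlet : \sum_x \sum_y stat x * P x y * (f x - e * f y) ^+ 2 = 0.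
  have -> : \sum_x \sum_y stat x * P x y * (f x - e * f y) ^+ 2 =
      \sum_x stat x * f x ^+ 2 + \sum_y stat y * f y ^+ 2
      + (- 2 * e) * \sum_x \sum_y stat x * P x y * (f x * f y).
    transitivity (\sum_x \sum_y (stat x * f x ^+ 2 * P x y
        + (stat x * P x y * f y ^+ 2 + (- 2 * e) * (stat x * P x y * (f x * f y))))).
      apply: eq_bigr => x _; apply: eq_bigr => y _.
      by ring: e1.
    rewrite -addrA.
    under eq_bigr => x _ do rewrite big_split -mulr_sumr P_sum mulr1 big_split /=.
    rewrite big_split; congr (_ + _); rewrite big_split; congr (_ + _) => /=.
      rewrite exchange_big; apply: eq_bigr => y _ /=.
      by rewrite -mulr_suml; case: sta => _ _ ->.
    by rewrite mulr_sumr; apply: eq_bigr => x _; rewrite mulr_sumr.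
  by rewrite stat_f cross; ring: e1.
have terms0 x y : 0 <= stat x * P x y * (f x - e * f y) ^+ 2.
  by rewrite mulr_ge0 ?sqr_ge0 // mulr_ge0.
(* Nonnegative terms of zero sum vanish, so [f x = e * f y] on transitions and the zero at [z]
   spreads. *)
have edge x y : 0 < P x y -> f x = 0 -> f y = 0.
  move=> Pxy fx0.
  have h0 : \sum_w stat x * P x w * (f x - e * f w) ^+ 2 = 0.
    by apply: (psumr_eq0P _ dirichlet) => // v _; apply: sumr_ge0.
  have /eqP : stat x * P x y * (f x - e * f y) ^+ 2 = 0.
    exact: (psumr_eq0P _ h0).
  rewrite fx0 sub0r mulf_eq0 sqrf_eq0 oppr_eq0 !mulf_eq0.
  rewrite (gt_eqF (stationary_gt0 x)) (gt_eqF Pxy) /= => /orP[/eqP e0|/eqP//].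
  by move: e1; rewrite e0 expr0n => /eqP; rewrite eq_sym oner_eq0.
move=> x; have := irreducible_ind (fun w => f w = 0) P_ge0 P_irr edge z (val x) fz.
by rewrite fE => /eqP; rewrite mulf_eq0 invr_eq0 (negbTE (sqrt_stat_neq0 _)) orbF => /eqP.
Qed.

(** * The quantum operator as a walk over the vectors [|x>|p_x>] with [x <> z] *)

Definition swap (k : XX n) : XX n := (k.2, k.1).

Lemma swapK : involutive swap. Proof. by case. Qed.

Lemma big_XX_psi x (F : XX n -> R) :
  \sum_k psi P x k * F k = \sum_y Num.sqrt (P x y) * F (x, y).
Proof.
transitivity (\sum_(k : XX n) psi P x (k.1, k.2) * F (k.1, k.2)).
  by apply: eq_bigr => -[].
rewrite -(pair_bigA _ (fun a b => psi P x (a, b) * F (a, b))) /=.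
rewrite (bigD1 x) //= [X in _ + X]big1 ?addr0 => [|a /negbTE ax].
  by apply: eq_bigr => y _; rewrite /psi eqxx.
by rewrite big1 // => b _; rewrite /psi /= ax mul0r.
Qed.

Lemma psi_orthonormal x y : dot (psi P x) (psi P y) = (x == y)%:R.
Proof.
rewrite /dot big_XX_psi /psi /=; case: eqP => [<-|_].
  by rewrite -[RHS](P_sum x); apply: eq_bigr => w _; rewrite -expr2 sqr_sqrtr.
by rewrite big1 // => w _; rewrite mulr0.
Qed.

(** The overlap with a swapped vector is [sqrt(P x y) * sqrt(P y x)]; reversibility expresses
    [P y x] through [P x y]. *)
Lemma psi_discriminant :
  discriminant (fun x : Xmz z => psi P (val x)) swap = Smz P stat (z := z).
Proof.
apply/funext => x; apply/funext => y; rewrite /discriminant /dot big_XX_psi /psi /=.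
rewrite (bigD1 (val y)) //= eqxx big1 => [|w /negbTE ->]; last by rewrite mulr0.
rewrite addr0 /Smz; set a := val x; set b := val y.
have -> : P b a = stat a / stat b * P a b.
  by rewrite mulrAC rev mulrC mulKf // gt_eqF // stationary_gt0.
rewrite sqrtrM ?divr_ge0 // sqrtrM // sqrtrV //.
have := sqr_sqrtr (P_ge0 a b); move: (Num.sqrt (P a b)) => w <-; ring.
Qed.

(** As [ref(A)] fixes [mu], the factor [1 - 2 |mu><mu|] just removes the term of [z] from the
    projector. *)
Lemma Uop_walk (f : XX n -> R) k :
  \sum_l Uop P z k l * f l = walk (fun x : Xmz z => psi P (val x)) swap f k.
Proof.
have UE l : Uop P z k l =
    2 * (\sum_(x | x != z) psi P x (swap k) * psi P x l) - (swap k == l)%:R.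
  rewrite /Uop /U2 -/(swap k) /refA.
  under eq_bigr => w _ do rewrite mulrBr.
  rewrite sumrB (bigD1 l) //= eqxx mulr1 big1 ?addr0 => [|w /negbTE ->]; last exact: mulr0.
  have -> : \sum_i (2 * projA P (swap k) i - (swap k == i)%:R) * (2 * psi P z i * psi P z l)
     = 2 * psi P z l * psi P z (swap k).
    transitivity (2 * psi P z l * (2 * dot (psi P z) (projA P (swap k))
         - dot (fun i => (swap k == i)%:R) (psi P z))).
      rewrite /dot [2 * \sum_i _]mulr_sumr -sumrB mulr_sumr.
      by apply: eq_bigr => i _; ring.
    rewrite dot_delta /projA dot_sum (bigD1 z) //= big1 => [|x /negbTE xz].
      rewrite addr0 dotZ psi_orthonormal eqxx mulr1; ring.
    by rewrite dotZ psi_orthonormal eq_sym xz mulr0.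
  by rewrite /projA (bigD1 z) //=; ring.
under eq_bigr => l _ do rewrite UE mulrBl.
rewrite sumrB -/(dot (fun l => (swap k == l)%:R) f) dot_delta /walk; congr (_ - _).
rewrite /embed /coembed /dot mulr_sumr.
under eq_bigr => l _ do rewrite -mulrA mulr_suml mulr_sumr big_Xmz.
rewrite exchange_big; apply: eq_bigr => x _ /=.
rewrite mulr_suml mulr_sumr; apply: eq_bigr => l _; ring.
Qed.

Lemma phit_embed :
  phit P stat z =1
  embed (fun x : Xmz z => psi P (val x)) (fun x => Num.sqrt (stat (val x))).
Proof. by move=> k; rewrite /phit big_Xmz. Qed.

Lemma ReD (v w : R[i]) : complex.Re (v + w) = complex.Re v + complex.Re w.
Proof. by case: v w => [? ?] [? ?]. Qed.

Lemma Re_sum (J : finType) (F : J -> R[i]) :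
  complex.Re (\sum_j F j) = \sum_j complex.Re (F j).
Proof. exact: (big_morph (@complex.Re R) ReD (erefl : complex.Re 0 = 0)). Qed.

Lemma ImD (v w : R[i]) : complex.Im (v + w) = complex.Im v + complex.Im w.
Proof. by case: v w => [? ?] [? ?]. Qed.

Lemma Im_sum (J : finType) (F : J -> R[i]) :
  complex.Im (\sum_j F j) = \sum_j complex.Im (F j).
Proof. exact: (big_morph (@complex.Im R) ImD (erefl : complex.Im 0 = 0)). Qed.

Lemma Re_applyC (A : XX n -> XX n -> R) (f : XX n -> R[i]) k :
  complex.Re (applyC A f k) = \sum_l A k l * complex.Re (f l).
Proof.
rewrite /applyC Re_sum.
by apply: eq_bigr => l _; case: (f l) => a b /=; rewrite mul0r subr0.
Qed.

Lemma Im_applyC (A : XX n -> XX n -> R) (f : XX n -> R[i]) k :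
  complex.Im (applyC A f k) = \sum_l A k l * complex.Im (f l).
Proof.
rewrite /applyC Im_sum.
by apply: eq_bigr => l _; case: (f l) => a b /=; rewrite mul0r addr0.
Qed.

Lemma normsqE (f : XX n -> R[i]) :
  normsq f = dot (fun k => complex.Re (f k)) (fun k => complex.Re (f k))
           + dot (fun k => complex.Im (f k)) (fun k => complex.Im (f k)).
Proof. by rewrite /normsq big_split. Qed.

(** Interface between the quantum and classical sides; since the [c j] are distinct, the [y j] are
    projections onto eigenspaces. *)
Definition spectral_decomp (m : nat) (c : 'I_m -> R) (y : 'I_m -> Xmz z -> R) :=
  [/\ injective c, forall j, eigenvec (Smz P stat (z := z)) (c j) (y j)
    & forall x : Xmz z, Num.sqrt (stat (val x)) = \sum_j y j x].

Lemma quantum_spectral (m : nat) (alpha : 'I_m -> R) (u0 um1 : XX n -> R[i])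
    (u : 'I_m -> XX n -> R[i]) :
  quantum_decomp P stat z alpha u0 um1 u ->
  normsq um1 = 0 /\
  exists2 y, spectral_decomp m (cos \o alpha) y
           & forall j, 2 * normsq (u j) = dot (y j) (y j).
Proof.
move=> [U0 U1 Uj [a_pi a_inj] dec].
pose T (x : Xmz z) := psi P (val x).
have T_orth x y : dot (T x) (T y) = (x == y)%:R by rewrite /T psi_orthonormal.
have disc : discriminant T swap = Smz P stat (z := z) := psi_discriminant.
have nounit e b : e ^+ 2 = 1 -> eigenvec (discriminant T swap) e b -> b =1 (fun=> 0).
  by rewrite disc; apply: Smz_no_unit_eigenvec.
have cs1 j : cos (alpha j) ^+ 2 + sin (alpha j) ^+ 2 = 1 by rewrite cos2Dsin2.
have s0 j : sin (alpha j) != 0 by rewrite gt_eqF // sin_gt0_pi.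
have c_inj : injective (cos \o alpha).
  move=> i j /= /cos_inj e; apply: a_inj; apply: e;
  by rewrite in_itv /=; case/andP: (a_pi i); case/andP: (a_pi j) => *; rewrite !ltW.
pose p j k := complex.Re (u j k); pose q j k := complex.Im (u j k).
have wp j : walk T swap (p j) =1
    (fun k => cos (alpha j) * p j k - sin (alpha j) * q j k).
  move=> k; rewrite -Uop_walk -Re_applyC Uj /p /q.
  by case: (u j k).
have wq j : walk T swap (q j) =1
    (fun k => sin (alpha j) * p j k + cos (alpha j) * q j k).
  move=> k; rewrite -Uop_walk -Im_applyC Uj /p /q.
  by case: (u j k) => ? ? /=; rewrite addrC.
pose p0 k := complex.Re (u0 k); pose q0 k := complex.Im (u0 k).
pose p1 k := complex.Re (um1 k); pose q1 k := complex.Im (um1 k).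
have wp0 : walk T swap p0 =1 p0 by move=> k; rewrite -Uop_walk -Re_applyC U0.
have wq0 : walk T swap q0 =1 q0 by move=> k; rewrite -Uop_walk -Im_applyC U0.
have wp1 : walk T swap p1 =1 (fun k => - p1 k).
  by move=> k; rewrite -Uop_walk -Re_applyC U1 /p1; case: (um1 k).
have wq1 : walk T swap q1 =1 (fun k => - q1 k).
  by move=> k; rewrite -Uop_walk -Im_applyC U1 /q1; case: (um1 k).
pose s (x : Xmz z) := Num.sqrt (stat (val x)).
have decR : embed T s =1 (fun k => p0 k + p1 k + \sum_j 2 * p j k).
  move=> k; rewrite -phit_embed.
  have /(congr1 (@complex.Re R)) /= -> := dec k.
  rewrite !ReD Re_sum.
  congr (_ + _); apply: eq_bigr => j _; rewrite /p; case: (u j k) => a b /=.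
  by rewrite mulr_natl mulr2n.
(* [phit] is real and conjugate pairs have no imaginary part, so the imaginary parts of [u0] and
   [um1] decompose the zero vector with no rotation terms ([m = 0]). *)
have decI : embed T (fun=> 0) =1 (fun k => q0 k + q1 k + \sum_(j < 0) 2 * 0).
  move=> k; rewrite big_ord0 addr0 /embed big1 => [|x _]; last by rewrite mul0r.
  have /(congr1 (@complex.Im R)) /= -> := dec k.
  rewrite !ImD Im_sum.
  rewrite [X in _ + X]big1 ?addr0 // => j _; case: (u j k) => a b /=.
  by rewrite subrr.
have p10 := minus_one_component_eq0 T swap swapK T_orth m _ _ _ _ p0 p1 s nounit
  s0 wp wq wp0 wp1 decR.
have q10 := minus_one_component_eq0 T swap swapK T_orth 0 (fun=> 0) (fun=> 0)
  (fun=> (fun=> 0)) (fun=> (fun=> 0)) q0 q1 (fun=> 0) nounit.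
have {}q10 : q1 =1 (fun=> 0) by apply: q10 => // -[].
split; first by rewrite normsqE !dot0 // addr0.
exists (spectral_component T m p).
  split=> // [j|x]; last first.
    exact: (decomp_coembed T swap swapK T_orth m p p0 p1 s nounit wp0 wp1 decR).
  rewrite -disc.
  exact: (spectral_component_eigenvec T swap swapK T_orth m _ _ p q cs1 wp wq).
move=> j; rewrite normsqE.
by rewrite (spectral_component_normsq T swap swapK T_orth m _ _ p q p0 p1 s
  nounit cs1 s0 c_inj wp wq wp0 wp1 decR).
Qed.

(** * Survival probabilities and the hitting time in spectral form *)

Lemma not_hit_prob0 (f : 'I_n -> R) :
  not_hit_prob P f z 0 = \sum_(x | x != z) f x.
Proof.
rewrite /not_hit_prob.
rewrite (reindex (fun x : 'I_n => [ffun _ : 'I_1 => x])) /=; last first.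
  exists (fun s : {ffun 'I_1 -> 'I_n} => s ord0) => [x _|s _]; first by rewrite ffunE.
  by apply/ffunP => i; rewrite ffunE; congr (s _); apply: val_inj; case: i => -[].
apply: eq_big => [x|x _]; last by rewrite /path_prob big_ord0 mulr1 ffunE.
by apply/forallP/idP => [/(_ ord0)|h i]; rewrite ffunE.
Qed.

(** Splitting off the first vertex of a path and summing over it; arbitrary initial weights [f] let
    the recursion close. *)
Lemma not_hit_probS (f : 'I_n -> R) t :
  not_hit_prob P f z t.+1 =
  not_hit_prob P (fun y => \sum_(x | x != z) f x * P x y) z t.
Proof.
pose cons_path (xs : 'I_n * {ffun 'I_t.+1 -> 'I_n}) : {ffun 'I_t.+2 -> 'I_n} :=
  [ffun i => if unlift ord0 i is Some j then xs.2 j else xs.1].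
have cons0 xs : cons_path xs ord0 = xs.1 by rewrite ffunE unlift_none.
have consS xs i : cons_path xs (lift ord0 i) = xs.2 i by rewrite ffunE liftK.
rewrite /not_hit_prob (reindex cons_path) /=; last first.
  exists (fun s : {ffun 'I_t.+2 -> 'I_n} => (s ord0, [ffun i => s (lift ord0 i)])).
    move=> [x s] _; rewrite cons0; congr pair.
    by apply/ffunP => i; rewrite ffunE consS.
  move=> s _; apply/ffunP => i; rewrite ffunE.
  by case: unliftP => [j|] -> //=; rewrite ffunE.
transitivity (\sum_(xs : 'I_n * {ffun 'I_t.+1 -> 'I_n} |
    (xs.1 != z) && [forall i, xs.2 i != z])
    f xs.1 * P xs.1 (xs.2 ord0) *
    \prod_(i < t) P (xs.2 (widen_ord (leqnSn t) i)) (xs.2 (lift ord0 i))).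
  apply: eq_big => [xs|xs _].
    apply/forallP/andP => [h|[h0 /forallP h] i].
      split; first by have := h ord0; rewrite cons0.
      by apply/forallP => i; have := h (lift ord0 i); rewrite consS.
    by case: (unliftP ord0 i) => [j|] ->; rewrite ?consS ?cons0.
  rewrite /path_prob big_ord_recl cons0 consS mulrA.
  have -> : widen_ord (leqnSn t.+1) ord0 = ord0 by apply: val_inj.
  rewrite cons0; congr (_ * _); apply: eq_bigr => i _.
  rewrite consS -(consS xs (widen_ord _ i)); congr (P (cons_path xs _) _).
  exact: val_inj.
rewrite -(pair_big (fun x => x != z)
  (fun s : {ffun 'I_t.+1 -> 'I_n} => [forall i, s i != z])
  (fun x s => f x * P x (s ord0) *
    \prod_(i < t) P (s (widen_ord (leqnSn t) i)) (s (lift ord0 i)))) /=.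
by rewrite exchange_big; apply: eq_bigr => s _; rewrite -mulr_suml.
Qed.

Section Spectral.
Variables (m : nat) (c : 'I_m -> R) (y : 'I_m -> Xmz z -> R).
Hypothesis spec : spectral_decomp m c y.

Let s (x : Xmz z) := Num.sqrt (stat (val x)).

Lemma Smz_sym x x' : Smz P stat (z := z) x x' = Smz P stat x' x.
Proof. by rewrite -psi_discriminant discriminant_sym //; exact: swapK. Qed.

Lemma dot_spectral_component j : dot (y j) s = dot (y j) (y j).
Proof.
have [c_inj eig dec] := spec.
rewrite (eq_dotr _ _ _ dec) dot_sum (bigD1 j) //= big1 ?addr0 // => i nij.
apply: (eigenvec_orthogonal _ Smz_sym _ _ _ _ (eig j) (eig i)).
by rewrite eq_sym (inj_eq c_inj).
Qed.

(** By orthogonality the sum is [|s|^2 = 1 - stat z]. *)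
Lemma sum_spectral_weights_le1 : \sum_j dot (y j) (y j) <= 1.
Proof.
have [_ _ dec] := spec.
under eq_bigr do rewrite -dot_spectral_component dotC.
rewrite -dot_sum -(eq_dotr _ _ _ dec).
have [_ <- _] := sta; rewrite (bigD1 z) //= big_Xmz.
rewrite [X in X <= _](_ : _ = \sum_(x : Xmz z) stat (val x)) ?lerDr //.
by apply: eq_bigr => x _; rewrite -expr2 sqr_sqrtr.
Qed.

Lemma not_hit_prob_spectral t :
  not_hit_prob P stat z t = \sum_j c j ^+ t * dot (y j) (y j).
Proof.
have [_ eig dec] := spec.
(* Weights of the form [s * \sum_j d j * y j] are stable under a step of the chain, which multiplies
   each [d j] by [c j]. *)
suff gen (f : 'I_n -> R) (d : 'I_m -> R) :
    (forall x : Xmz z, f (val x) = s x * \sum_j d j * y j x) ->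
    not_hit_prob P f z t = \sum_j d j * (c j ^+ t * dot (y j) (y j)).
  rewrite (gen _ (fun=> 1)) => [|x]; first by apply: eq_bigr => j _; rewrite mul1r.
  under eq_bigr do rewrite mul1r.
  by rewrite -dec -expr2 sqr_sqrtr.
elim: t f d => [|t IH] f d fE.
  rewrite not_hit_prob0 big_Xmz.
  under eq_bigr => x _ do rewrite fE.
  rewrite -/(dot s (fun x => \sum_j d j * y j x)) dot_sum.
  by apply: eq_bigr => j _; rewrite dotZ dotC dot_spectral_component expr0 mul1r.
rewrite not_hit_probS (IH _ (fun j => d j * c j)) => [|x].
  by apply: eq_bigr => j _; rewrite exprS !mulrA.
rewrite big_Xmz.
(* Detailed balance turns forward propagation of [s * g] by [P] into [s * (S g)]. *)
transitivity (s x * \sum_w Smz P stat x w * \sum_j d j * y j w).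
  rewrite mulr_sumr; apply: eq_bigr => w _; rewrite fE.
  have sw : s w != 0 by apply: sqrt_stat_neq0.
  have e : s x ^+ 2 * P (val x) (val w) = s w ^+ 2 * P (val w) (val x).
    by rewrite !sqr_sqrt_stat.
  rewrite /Smz -/(s x) -/(s w).
  transitivity (s x ^+ 2 * P (val x) (val w) / s w * (\sum_j d j * y j w)).
    by rewrite e; field.
  by field.
congr (_ * _); under eq_bigr do rewrite mulr_sumr.
rewrite exchange_big; apply: eq_bigr => j _ /=.
by rewrite -mulrA -eig mulr_sumr; apply: eq_bigr => w _; rewrite mulrCA.
Qed.

(** Each [j] contributes one convergent geometric series. *)
Lemma HT_spectral : (forall j, `|c j| < 1) ->
  HT P stat z = \sum_j dot (y j) (y j) / (1 - c j).
Proof.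
move=> c1; rewrite /HT.
under eq_fun => k do under eq_bigr => t _ do rewrite not_hit_prob_spectral.
under eq_fun => k do rewrite sumEFin.
have cvg (w : 'I_m -> R) : ((fun k => \sum_(0 <= t < k) \sum_j c j ^+ t * w j) @ \oo
    --> \sum_j w j / (1 - c j))%classic.
  have -> : (fun k => \sum_(0 <= t < k) \sum_j c j ^+ t * w j) =
      (fun k => \sum_j series (geometric (w j) (c j)) k).
    apply/funext => k; rewrite exchange_big; apply: eq_bigr => j _.
    by apply: eq_bigr => t _; rewrite mulrC.
  elim: (index_enum _) => [|j r IH].
    rewrite big_nil (_ : (fun=> _) = (fun=> 0)); first exact: cvg_cst.
    by apply/funext => k; rewrite big_nil.
  rewrite big_cons (_ : (fun=> _) = (fun k => series (geometric (w j) (c j)) k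
      + \sum_(i <- r) series (geometric (w i) (c i)) k)).
    by apply: cvgD => //; exact: cvg_geometric_series.
  by apply/funext => k; rewrite big_cons.
rewrite (EFin_lim (f := fun k => \sum_(0 <= t < k) \sum_j c j ^+ t * dot (y j) (y j))).
  by rewrite (cvg_lim _ (cvg _)).
exact: (cvgP _ (cvg _)).
Qed.

End Spectral.
End Chain.

(** * Elementary bounds on sine and cosine *)

Section Trigonometry.
Import numFieldNormedType.Exports.
Context {R : realType}.

Lemma sin_le_id (x : R) : 0 <= x -> sin x <= x.
Proof.
move=> x0.
have cont : {within `[0, x], continuous (@sin R)}%classic.
  by apply: continuous_subspaceT => t; exact: continuous_sin.
have [a _] := MVT_segment x0 (fun t _ => is_derive_sin t) cont.
rewrite sin0 !subr0 => ->.
by rewrite ler_piMl // cos_le1.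
Qed.

(** Half-angle formula [1 - cos x = 2 sin(x/2)^2] and [sin(x/2) <= x/2]. *)
Lemma one_sub_cos_le (x : R) : 0 <= x <= pi -> 1 - cos x <= x ^+ 2 / 2.
Proof.
move=> /andP[x0 xpi].
have h0 : 0 <= x / 2 by lra.
have hs : 0 <= sin (x / 2) by apply: sin_ge0_pi; rewrite h0; lra.
have hl := sin_le_id _ h0.
have h : cos x = 1 - 2 * sin (x / 2) ^+ 2.
  rewrite {1}(splitr x) cosD -!expr2.
  have := cos2Dsin2 (x / 2); lra.
rewrite h; have : sin (x / 2) ^+ 2 <= (x / 2) ^+ 2 by rewrite lerXn2r ?nnegrE.
lra.
Qed.

Lemma cos_norm_lt1 (x : R) : 0 < x < pi -> `|cos x| < 1.
Proof.
move=> xpi; have s0 := sin_gt0_pi xpi.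
rewrite -(@ltr_pXn2r _ 2) ?nnegrE ?normr_ge0 // expr1n real_normK ?num_real //.
by rewrite -(cos2Dsin2 x) ltrDl exprn_gt0.
Qed.

End Trigonometry.

(** * Cauchy-Schwarz, Parseval, and infima under the square root *)

Lemma sum_sqr_le {R : realDomainType} {J : finType} (w v : J -> R) :
  (forall j, 0 <= w j) -> \sum_j w j <= 1 ->
  (\sum_j w j * v j) ^+ 2 <= \sum_j w j * v j ^+ 2.
Proof.
move=> w0 w1; set A := \sum_j w j * v j.
have : 0 <= \sum_j w j * (v j - A) ^+ 2.
  by apply: sumr_ge0 => j _; rewrite mulr_ge0 ?sqr_ge0.
have -> : \sum_j w j * (v j - A) ^+ 2 =
    \sum_j w j * v j ^+ 2 - 2 * A * A + A ^+ 2 * \sum_j w j.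
  transitivity (\sum_j (w j * v j ^+ 2 + - 2 * A * (w j * v j) + A ^+ 2 * w j)).
    by apply: eq_bigr => j _; ring.
  by rewrite !big_split /= -!mulr_sumr -/A; ring.
have : A ^+ 2 * \sum_j w j <= A ^+ 2 by rewrite ler_piMr ?sqr_ge0.
lra.
Qed.

(** Parseval: a right inverse of a square matrix is a left inverse, so orthonormal rows force
    orthonormal columns. *)
Lemma orthonormal_complete {R : comRingType} {I : finType} (v : I -> I -> R) :
  (forall j k, \sum_x v j x * v k x = (j == k)%:R) ->
  forall a b : I -> R, dot a b = \sum_k dot (v k) a * dot (v k) b.
Proof.
move=> orth.
have orth' x y : \sum_k v k x * v k y = (x == y)%:R.
  pose V := \matrix_(i < #|I|, j < #|I|) v (enum_val i) (enum_val j).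
  have : V *m V^T = 1%:M.
    apply/matrixP => i j; rewrite !mxE.
    under eq_bigr => k _ do rewrite !mxE.
    rewrite -(inj_eq enum_val_inj) -orth (reindex enum_rank) /=.
      by apply: eq_bigr => k _; rewrite enum_rankK.
    exact/onW_bij/enum_rank_bij.
  move/mulmx1C/matrixP/(_ (enum_rank x) (enum_rank y)); rewrite !mxE.
  rewrite (inj_eq enum_rank_inj) => <-.
  rewrite [RHS](reindex enum_rank) /=; last exact/onW_bij/enum_rank_bij.
  by apply: eq_bigr => k _; rewrite !mxE !enum_rankK.
move=> a b.
transitivity (dot a (fun x => \sum_y \sum_k v k x * v k y * b y)).
  apply: eq_dotr => x; under eq_bigr do rewrite -mulr_suml orth'.
  by rewrite -[LHS](dot_delta x).
rewrite /dot; under eq_bigr => x _ do rewrite exchange_big mulr_sumr.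
rewrite exchange_big; apply: eq_bigr => k _ /=.
rewrite mulr_suml; apply: eq_bigr => x _.
rewrite !mulr_sumr; apply: eq_bigr => w _; ring.
Qed.

(** Squaring and square root exchange the sets monotonically; nonemptiness and the lower bound 0
    make both infima genuine. *)
Lemma inf_sqrt {R : realType} (A B : set R) :
  (A !=set0)%classic -> (B !=set0)%classic ->
  (forall x, A x -> 0 <= x /\ B (x ^+ 2)) ->
  (forall x, B x -> 0 <= x /\ A (Num.sqrt x)) ->
  inf A = Num.sqrt (inf B).
Proof.
move=> A0 B0 AB BA.
have lA : has_lbound A by exists 0 => x /AB[].
have lB : has_lbound B by exists 0 => x /BA[].
have iA : 0 <= inf A by apply: lb_le_inf => // x /AB[].
apply/le_anti/andP; split.
  rewrite -[inf A]ger0_norm // -sqrtr_sqr ler_wsqrtr //.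
  apply: lb_le_inf => // x Bx; have [x0 Ax] := BA _ Bx.
  by rewrite -[leRHS]sqr_sqrtr // lerXn2r ?nnegrE ?sqrtr_ge0 // ge_inf.
apply: lb_le_inf => // x Ax; have [x0 Bx] := AB _ Ax.
by rewrite -[leRHS]ger0_norm // -sqrtr_sqr ler_wsqrtr // ge_inf.
Qed.

(** * Comparison of the quantum and classical hitting times *)

Theorem theorem9 (R : realType) (n : nat) (P : 'M[R]_n) (stat : 'I_n -> R) :
  ergodic P -> stationary P stat -> reversible P stat ->
  eigenvalues_positive P ->
  forall z : 'I_n,
    (* (1) *)
    (forall (m : nat) (alpha : 'I_m -> R) (u0 um1 : XX n -> R[i])
            (u : 'I_m -> XX n -> R[i]),
        quantum_decomp P stat z alpha u0 um1 u ->
        QHT alpha um1 u <= Num.sqrt (HT P stat z / 2))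
    /\
    (* (2) *)
    (forall (v : Xmz z -> Xmz z -> R) (theta : Xmz z -> R)
            (m : nat) (alpha : 'I_m -> R) (u0 um1 : XX n -> R[i])
            (u : 'I_m -> XX n -> R[i]),
        classical_eigenbasis P stat v theta ->
        quantum_decomp P stat z alpha u0 um1 u ->
        forall eps : R, 0 < eps < 1 ->
          QHT_eps alpha um1 u eps = Num.sqrt (HT_eps stat v theta eps)).
Proof.
move=> erg sta rev _ z; split=> [m alpha u0 um1 u qd|v theta m alpha u0 um1 u].
  have [um10 [y spec wE]] := quantum_spectral _ _ erg sta rev _ _ _ _ _ _ qd.
  have [_ _ _ [a_pi _] _] := qd.
  have w0 j : 0 <= dot (y j) (y j) by exact: dot_ge0.
  rewrite /QHT um10 mul0r addr0.
  under eq_bigr => j _ do rewrite wE.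
  apply: le_trans (ler_norm _) _; rewrite -sqrtr_sqr ler_wsqrtr //.
  have w1 := sum_spectral_weights_le1 _ _ erg sta rev _ _ _ _ spec.
  apply: le_trans (sum_sqr_le _ _ w0 w1) _.
  rewrite (HT_spectral _ _ erg sta rev _ _ _ _ spec) => [|j]; last exact: cos_norm_lt1.
  rewrite mulr_suml; apply: ler_sum => j _.
  (* Termwise, [1 / alpha^2 <= 1 / (2 (1 - cos alpha))]. *)
  rewrite -mulrA ler_wpM2l //= exprVn -invfM.
  have c1 : 0 < 1 - cos (alpha j).
    rewrite subr_gt0; apply: le_lt_trans (ler_norm _) _; exact: cos_norm_lt1.
  have /andP[a0 api] := a_pi j.
  have : 1 - cos (alpha j) <= alpha j ^+ 2 / 2.
    by apply: one_sub_cos_le; rewrite !ltW.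
  rewrite lef_pV2 ?posrE ?mulr_gt0 ?exprn_gt0 //; lra.
move=> [orth eig th_pi] qd eps /andP[eps0 eps1].
have [um10 [y spec wE]] := quantum_spectral _ _ erg sta rev _ _ _ _ _ _ qd.
have [_ _ _ [a_pi _] _] := qd.
have [_ y_eig dec] := spec.
pose s (x : Xmz z) := Num.sqrt (stat (val x)).
have w0 j : 0 <= dot (y j) (y j) by exact: dot_ge0.
have yv j k : alpha j != theta k -> dot (v k) (y j) = 0.
  move=> ne; apply: (eigenvec_orthogonal _ (Smz_sym _ _ erg sta rev z) _ _ _ _
    (eig k) (y_eig j)).
  apply: contraNneq ne => /= e; apply/eqP/esym/(cos_inj _ _ e).
    have := th_pi k; rewrite in_itv /= => /andP[h1 h2]; have := pi_gt0 R; lra.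
  by have := a_pi j; rewrite in_itv /= => /andP[h1 h2]; rewrite !ltW.
have tailE t : 0 <= t -> QH_tail alpha um1 u t = Hz_tail stat v theta (t ^+ 2).
  move=> t0; rewrite /QH_tail /Hz_tail um10 !if_same addr0 ltNge t0 addr0.
  rewrite ltNge sqr_ge0 addr0.
  (* The weight [|y_j|^2 = <y_j, s>] is expanded in the basis [v]. *)
  transitivity
    (\sum_j \sum_k if t < (alpha j)^-1 then nu stat v k * dot (v k) (y j) else 0).
    apply: eq_bigr => j _; case: ifP => _; last by rewrite big1.
    rewrite wE -(dot_spectral_component _ _ erg sta rev _ _ _ _ spec).
    by rewrite dotC (orthonormal_complete v).
  rewrite exchange_big; apply: eq_bigr => k _ /=.
  have tk : (t ^+ 2 < (theta k ^+ 2)^-1) = (t < (theta k)^-1).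
    have /andP[th0 _] := th_pi k.
    by rewrite -exprVn ltr_pXn2r // nnegrE ?invr_ge0 ltW.
  (* Only terms with [alpha j = theta k] survive, so the threshold may be tested on [theta k];
     summing the [y j] back to [s] then gives [nu ^+ 2]. *)
  rewrite tk; transitivity
    (\sum_j if t < (theta k)^-1 then nu stat v k * dot (v k) (y j) else 0).
    apply: eq_bigr => j _; case: (eqVneq (alpha j) (theta k)) => [->//|/yv ->].
    by rewrite mulr0 !if_same.
  case: ifP => _; last by rewrite big1.
  by rewrite -mulr_sumr -dot_sum -(eq_dotr _ _ _ dec) expr2.
(* At a negative threshold the tail is the total mass 1, which exceeds [eps]. *)
have Q_ge0 t : QH_tail alpha um1 u t <= eps -> 0 <= t.
  move=> h; rewrite leNgt; apply/negP => t0; move: h; rewrite leNgt => /negP; apply.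
  rewrite /QH_tail t0 um10 if_same addr0 subr0.
  rewrite (eq_bigr (fun j => 2 * normsq (u j))); first by rewrite addrC subrK.
  by move=> j _; rewrite (lt_trans t0) // invr_gt0; case/andP: (a_pi j).
have H_ge0 t : Hz_tail stat v theta t <= eps -> 0 <= t.
  move=> h; rewrite leNgt; apply/negP => t0; move: h; rewrite leNgt => /negP; apply.
  rewrite /Hz_tail t0.
  rewrite (eq_bigr (fun j => nu stat v j ^+ 2)); first by rewrite addrC subrK.
  by move=> j _; rewrite (lt_trans t0) // invr_gt0 exprn_gt0 //; case/andP: (th_pi j).
(* [M] dominates every [1 / alpha j], so the tail vanishes there and both sets are nonempty. *)
pose M := \sum_j (alpha j)^-1.
have aV0 j : 0 <= (alpha j)^-1 by rewrite invr_ge0 ltW //; case/andP: (a_pi j).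
have M0 : 0 <= M by apply: sumr_ge0.
have QM : QH_tail alpha um1 u M <= eps.
  rewrite /QH_tail um10 if_same addr0 ltNge M0 addr0 big1 ?ltW // => j _.
  by rewrite ltNge /M (bigD1 j) //= lerDl sumr_ge0.
apply: inf_sqrt => /=.
- by exists M.
- by exists (M ^+ 2); rewrite /= -tailE.
- by move=> t h; have t0 := Q_ge0 _ h; rewrite -tailE.
- by move=> t h; have t0 := H_ge0 _ h; rewrite tailE ?sqrtr_ge0 // sqr_sqrtr.
Qed.
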